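(* Let $m\ge 2$ and $n$ be integers. If $m \leq n \leq R_{m-1}-m$, then $\mathfrak{pr}(K_{m,n}) \leq R_{m-1}$.
   Context: All graphs are finite and simple. A coprime labeling of a graph $G$ is an injection $f\colon V(G)\to\{1,2,\dots,k\}$, for some integer $k\ge |V(G)|$, such that $\gcd(f(u),f(v))=1$ whenever $(u,v)\in E(G)$. The minimum coprime number $\mathfrak{pr}(G)$ is the least $k$ for which such a labeling exists. $K_{m,n}$ is the complete bipartite graph with parts of sizes $m$ and $n$. For $k\ge 1$, the $k$-th Ramanujan prime $R_k$ is the least integer such that $\pi(x)-\pi(x/2)\ge k$ for all $x\ge R_k$, where $\pi(x)$ is the number of primes less than or equal to $x$. *)

(* Defs.v *)
From mathcomp Require Import all_boot all_order all_algebra.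
From mathcomp Require Import boolp classical_sets reals.

Set Implicit Arguments.
Unset Strict Implicit.
Unset Printing Implicit Defensive.

Import Order.TTheory GRing.Theory Num.Theory.

Record sgraph := SGraph {
  vertex :> finType;
  adj : rel vertex;
  adj_sym : symmetric adj;
  adj_irrefl : irreflexive adj
}.

Section CoprimeLabeling.
Variable G : sgraph.

(* ['I_k.+1] is {0, ..., k}; the first conjunct below removes the label 0. *)
Definition coprime_labeling (k : nat) (f : {ffun G -> 'I_k.+1}) : bool :=
  [&& [forall v, 0 < f v], injectiveb f
    & [forall u, forall v, adj u v ==> (gcdn (f u) (f v) == 1)]].

Definition has_coprime_labeling (k : nat) : bool :=
  (#|G| <= k) && [exists f : {ffun G -> 'I_k.+1}, coprime_labeling f].

(* Label the vertices with pairwise distinct primes. *)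
Lemma ex_coprime_labeling : exists k, has_coprime_labeling k.
Proof.
pose next p := sval (prime_above p).
pose q i := iter i next 2.
have q_prime i : prime (q i).
  by case: i => [//|i]; rewrite /q iterS /next; case: (prime_above _).
have q_ltS i : q i < q i.+1.
  by rewrite {2}/q iterS /next -/(q i); case: (prime_above _).
have q_lt : {homo q : i j / i < j} := homo_ltn ltn_trans q_ltS.
have q_inj : injective q.
  move=> i j eq_q; case: (ltngtP i j) => // /q_lt; by rewrite eq_q ltnn.
have q_ge i : i <= q i by elim: i => // i IHi; apply: leq_ltn_trans (q_ltS i).
exists (q #|G|); rewrite /has_coprime_labeling q_ge /=.
pose f := [ffun v : G => inord (q (enum_rank v)) : 'I_(q #|G|).+1].
have fE v : f v = q (enum_rank v) :> nat.
  by rewrite ffunE inordK // ltnS ltnW // q_lt.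
apply/existsP; exists f; apply/and3P; split.
- by apply/forallP=> v; rewrite fE prime_gt0.
- apply/injectiveP=> u v /(congr1 val) /=; rewrite !fE.
  by move/q_inj/val_inj/enum_rank_inj.
- apply/forallP=> u; apply/forallP=> v; apply/implyP=> uv.
  rewrite !fE -/(coprime _ _) prime_coprime // dvdn_prime2 //.
  apply/eqP=> /q_inj/val_inj/enum_rank_inj eq_uv.
  by rewrite eq_uv adj_irrefl in uv.
Qed.

Definition min_coprime_number : nat := ex_minn ex_coprime_labeling.

End CoprimeLabeling.

Section CompleteBipartite.
Variables m n : nat.

Definition bipartite_adj (u v : 'I_m + 'I_n) : bool :=
  match u, v with
  | inl _, inr _ | inr _, inl _ => true
  | _, _ => false
  end.

Lemma bipartite_adj_sym : symmetric bipartite_adj.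
Proof. by case=> ? []. Qed.

Lemma bipartite_adj_irrefl : irreflexive bipartite_adj.
Proof. by case. Qed.

Definition complete_bipartite : sgraph :=
  SGraph bipartite_adj_sym bipartite_adj_irrefl.

End CompleteBipartite.

Section Ramanujan.
Variable R : realType.

(* [Num.truncn x] is the floor of [x] when [0 <= x], and [0] otherwise. *)
Definition prime_pi (x : R) : nat :=
  #|[set p : 'I_(Num.truncn x).+1 | prime p]|.

(* The subtraction is exact, as [prime_pi (x / 2) <= prime_pi x] when
   [0 <= r%:R <= x]. *)
Definition ramanujan_bound (k r : nat) : Prop :=
  forall x : R, (r%:R <= x)%R -> k <= prime_pi x - prime_pi (x / 2)%R.

(* For [k >= 1] no integer [r < 2] satisfies the condition (take [x = r]), so
   the least such integer is the least such natural number. *)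
Definition is_ramanujan_prime (k r : nat) : Prop :=
  ramanujan_bound k r /\ forall s : nat, ramanujan_bound k s -> r <= s.

(* The [k]-th Ramanujan prime. It exists for every [k] by Ramanujan's theorem,
   so the default value [0] of [xget] is never used. *)
Definition ramanujan_prime (k : nat) : nat :=
  xget 0 [set r | is_ramanujan_prime k r]%classic.

End Ramanujan.

(* Main.v *)
Require Import Defs.
From mathcomp Require Import all_boot all_order all_algebra.
From mathcomp Require Import boolp classical_sets reals.
(* Reimported so that finite-set lemmas take precedence over their homonyms for
   classical sets. *)
From mathcomp Require Import fintype finset zify.

(** Write [r] for the Ramanujan prime [R_(m-1)]. Taking [x = r] in the
    definition of [r] gives at least [m - 1] primes in the interval
    [(r / 2, r]]. Each of them is coprime to every other positive integer up
    to [r], because its second multiple already exceeds [r]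
    ([large_prime_coprime]). Label the part of size [m] with [1] and [m - 1]
    of these primes: the remaining [r - m] positive integers up to [r] are all
    coprime to these labels, so any [n <= r - m] of them serve for the other
    part. *)

Set Implicit Arguments.
Unset Strict Implicit.
Unset Printing Implicit Defensive.

Import Order.TTheory GRing.Theory Num.Theory.

Lemma large_prime_coprime p k b :
  prime p -> k < p.*2 -> 0 < b <= k -> b != p -> coprime p b.
Proof.
move=> p_prime k_lt /andP[b_gt0 b_le] b_neq; rewrite prime_coprime //.
apply/negP=> /dvdnP[c def_b]; subst b.
by move: b_gt0 b_le b_neq; case: c => [|[|c]]; rewrite ?mul1n ?eqxx //; nia.
Qed.

(** Labeling a complete bipartite graph amounts to choosing two disjoint label
    sets that are coprime across; the parts are then injected into them. *)
Lemma min_coprime_number_bipartite_le m n k (A B : {set 'I_k.+1}) :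
    m <= #|A| -> n <= #|B| -> [disjoint A & B] ->
    {in A :|: B, forall i : 'I_k.+1, 0 < i} ->
    {in A & B, forall a b : 'I_k.+1, coprime a b} ->
  min_coprime_number (complete_bipartite m n) <= k.
Proof.
move=> mA nB disjAB pos_AB copAB.
have enumA i : enum_val (widen_ord mA i) \in A by exact: enum_valP.
have enumB j : enum_val (widen_ord nB j) \in B by exact: enum_valP.
rewrite /min_coprime_number; case: ex_minnP => l _; apply.
apply/andP; split.
  rewrite card_sum !card_ord; apply: leq_trans (leq_add mA nB) _.
  move: disjAB; rewrite -leq_card_setU => /eqP <-.
  have sub : A :|: B \subset [set~ ord0].
    by apply/subsetP=> i /pos_AB; rewrite !inE -lt0n.
  by rewrite (leq_trans (subset_leq_card sub)) // cardsC1 card_ord.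
pose f : {ffun complete_bipartite m n -> 'I_k.+1} := [ffun v =>
  match v with
  | inl i => enum_val (widen_ord mA i)
  | inr j => enum_val (widen_ord nB j)
  end].
apply/existsP; exists f; apply/and3P; split.
- by apply/forallP=> -[] i; rewrite ffunE pos_AB // inE ?enumA ?enumB ?orbT.
- apply/injectiveP=> -[] i [] j; rewrite !ffunE.
  + by move=> /enum_val_inj /(congr1 val) /= /val_inj ->.
  + move=> eq_ij; have := enumA i.
    by rewrite eq_ij => /(disjointFr disjAB); rewrite enumB.
  + move=> eq_ij; have := enumA j.
    by rewrite -eq_ij => /(disjointFr disjAB); rewrite enumB.
  + by move=> /enum_val_inj /(congr1 val) /= /val_inj ->.
- apply/forallP=> -[] i; apply/forallP=> -[] j; apply/implyP=> //= _;
    rewrite !ffunE -/(coprime _ _); first exact: copAB.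
  by rewrite coprime_sym; exact: copAB.
Qed.

Definition large_primes k : {set 'I_k.+1} :=
  [set p : 'I_k.+1 | prime p & k < (p : nat).*2].

(** Rounding [k / 2] down loses nothing: for integers [p], the conditions
    [p <= k / 2] and [p.*2 <= k] agree, so the primes that [prime_pi] counts in
    [(k / 2, k]] are the large ones. *)
Lemma prime_pi_sub_half_le (R : realType) k :
  prime_pi (k%:R : R)%R - prime_pi (k%:R / 2 : R)%R <= #|large_primes k|.
Proof.
rewrite leq_subLR /prime_pi natrK; set h := Num.truncn (_ / 2)%R.
have le_h (p : nat) : p.*2 <= k -> p <= h.
  move=> pk; rewrite /h truncn_ge_nat ?divr_ge0 ?ler0n //.
  by rewrite ler_pdivlMr ?ltr0n // -natrM ler_nat muln2.
rewrite -(cardsID (large_primes k) [set p : 'I_k.+1 | prime p]) addnC.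
apply: leq_add; last first.
  exact/subset_leq_card/subsetIr.
(* The primes that are not large are at most [h]; [inord] moves them into the
   smaller index type without changing their value. *)
have inordE (p : 'I_k.+1) : prime p -> p \notin large_primes k ->
    (inord p : 'I_h.+1) = p :> nat.
  by move=> p_prime; rewrite inE p_prime -leqNgt => /le_h p_le; rewrite inordK.
rewrite -(card_in_imset (f := fun p : 'I_k.+1 => inord p : 'I_h.+1)).
  apply/subset_leq_card/subsetP=> q /imsetP[p /setDP[]].
  by rewrite inE => pp np ->; rewrite inE inordE.
move=> p q /setDP[]; rewrite inE => pp np /setDP[]; rewrite inE => pq nq.
move/(congr1 val) => /=; rewrite (inordE _ pp np) (inordE _ pq nq).
exact: val_inj.
Qed.

(** The part of size [m] gets [1] and [m.-1] of the large primes, and the other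
    part draws from all the remaining positive labels. *)
Lemma min_coprime_number_le_of_large_primes m n k :
    0 < m -> m + n <= k -> m.-1 <= #|large_primes k| ->
  min_coprime_number (complete_bipartite m n) <= k.
Proof.
move=> m_gt0 mnk /card_geqP[s [s_uniq s_size sP]].
have one_lt : 1 < k.+1 by lia.
pose one := Ordinal one_lt; pose A := one |: [set p in s].
have cardA : #|A| = m.
  rewrite cardsU1 cardsE (card_uniqP s_uniq) s_size inE.
  have /negbTE-> : one \notin s by apply/negP=> /sP; rewrite inE.
  by rewrite add1n prednK.
have posA a : a \in A -> 0 < a.
  case/setU1P=> [->|]//; rewrite inE => /sP.
  by rewrite inE => /andP[/prime_gt0].
have subA : A \subset [set~ ord0].
  by apply/subsetP=> a /posA; rewrite !inE -lt0n.
apply: (@min_coprime_number_bipartite_le _ _ _ A ([set~ ord0] :\: A)).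
- by rewrite cardA.
- by rewrite cardsDS // cardsC1 card_ord cardA; lia.
- by rewrite -setI_eq0 setDE setICA setICr setI0.
- move=> i /setUP[/posA//|/setDP[]].
  by rewrite !inE -lt0n.
- move=> a b aA /setDP[]; rewrite in_setC1 -lt0n => b_gt0 bNA.
  case/setU1P: (aA) => [->|]; first exact: coprime1n.
  rewrite inE => /sP; rewrite inE => /andP[pa ka].
  apply: large_prime_coprime pa ka _ _; first by rewrite b_gt0 -ltnS ltn_ord.
  by apply: contraNneq bNA => /val_inj->.
Qed.

(** A positive value cannot be the default [0] of [xget], so it is a genuine
    Ramanujan prime. The range [m <= n <= R_(m-1) - m] with [m >= 2] forces
    [R_(m-1)] to be positive. *)
Lemma ramanujan_primeP (R : realType) k :
  0 < ramanujan_prime R k -> ramanujan_bound R k (ramanujan_prime R k).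
Proof.
by rewrite /ramanujan_prime; case: xgetP => [r _ []|].
Qed.

Theorem theorem4p3 (R : realType) (m n : nat) (hm : 2 <= m)
    (hmn : m <= n) (hn : n <= ramanujan_prime R (m - 1) - m) :
  min_coprime_number (complete_bipartite m n) <= ramanujan_prime R (m - 1).
Proof.
have r_gt0 : 0 < ramanujan_prime R (m - 1) by lia.
apply: min_coprime_number_le_of_large_primes; [lia | lia |].
rewrite -subn1; apply: leq_trans (prime_pi_sub_half_le R _).
exact: ramanujan_primeP r_gt0 _ (lexx _).
Qed.
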